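(* Let $n \ge 2$ and $k \ge n+3$, and let $\Gamma : \mathbb{S}^n \to \{1,2,\dots,k\}$ be a full $k$-coloring of the standard $n$-sphere $\mathbb{S}^n$. Then there exists an $(n-1)$-sphere $S \subset \mathbb{S}^n$ that contains at least $n+2$ different colors, i.e. $|\Gamma(S)| \ge n+2$.
   Context: The standard $n$-sphere is $\mathbb{S}^n = \{(x_0,\dots,x_n)\in\mathbb{R}^{n+1} : \sum_{i=0}^n x_i^2 = 1\}$. A full $k$-coloring of $\mathbb{S}^n$ is a surjective map $\Gamma:\mathbb{S}^n\to\{1,\dots,k\}$ (equivalently, a partition of $\mathbb{S}^n$ into $k$ nonempty sets); no continuity, measurability or other regularity is assumed. An $(n-1)$-sphere in $\mathbb{S}^n$ is a set of the form $P\cap\mathbb{S}^n$, where $P$ is an affine hyperplane of $\mathbb{R}^{n+1}$ (not necessarily through the origin) that meets the open ball bounded by $\mathbb{S}^n$ (so that the intersection is neither empty nor a single point). *)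

(* Defs.v *)
From HB Require Import structures.
From mathcomp Require Import all_boot all_order all_algebra.
From mathcomp Require Import mathcomp_extra boolp classical_sets functions.
From mathcomp Require Import cardinality reals.

Set Implicit Arguments.
Unset Strict Implicit.
Unset Printing Implicit Defensive.

Import Order.TTheory GRing.Theory Num.Theory.

Local Open Scope classical_set_scope.
Local Open Scope ring_scope.

(* Everything is Euclidean: the norm that MathComp-Analysis puts on 'rV[R]_m
   is the sup norm, so the Euclidean norm is written out as a sum of squares. *)

Definition sphere (R : realType) (n : nat) : set 'rV[R]_n.+1 :=
  [set x | \sum_i x 0 i ^+ 2 = 1].

Definition open_unit_ball (R : realType) (n : nat) : set 'rV[R]_n.+1 :=
  [set x | \sum_i x 0 i ^+ 2 < 1].

Definition affine_hyperplane (R : realType) (n : nat) (P : set 'rV[R]_n.+1) :=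
  exists (a : 'rV[R]_n.+1) (b : R),
    a != 0 /\ P = [set x | \sum_i a 0 i * x 0 i = b].

Definition codim1_sphere (R : realType) (n : nat) (S : set 'rV[R]_n.+1) :=
  exists P : set 'rV[R]_n.+1,
    [/\ affine_hyperplane P, P `&` @open_unit_ball R n !=set0
      & S = P `&` @sphere R n].

(* The domain is the sphere itself, as the subtype [set_type (sphere R n)]. The
   colors 1, ..., k are the elements of ['I_k]; only their number matters. *)
Definition full_coloring (R : realType) (n k : nat)
    (Gamma : @sphere R n -> 'I_k) :=
  set_surj [set: @sphere R n] [set: 'I_k] Gamma.

(* Main.v *)
Require Import Defs.
From HB Require Import structures.
From mathcomp Require Import all_boot all_order all_algebra.
From mathcomp Require Import mathcomp_extra boolp classical_sets functions.
From mathcomp Require Import cardinality reals.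
From mathcomp Require Import ring lra.

Set Implicit Arguments.
Unset Strict Implicit.
Unset Printing Implicit Defensive.

Import Order.TTheory GRing.Theory Num.Theory.

Local Open Scope ring_scope.

(** A point [x] of the sphere is represented by the vector [(1, x)], which is
null for the Lorentzian form [mink]; any nonzero null vector is a multiple of
such a vector, so it has a color. A hyperplane section of the sphere consists
of the null vectors in a hyperplane of the vector space, and the hyperplane
automatically meets the open ball as soon as it contains two points of the
sphere. Colors may be merged until exactly [n + 3] are left. Suppose that no
hyperplane contains [n + 2] colors. Then [n + 2] null vectors of different
colors are linearly independent ([color_reps_indep]); in particular four such
vectors are ([rainbow_independent]), so a circle carries at most three colors,
and a null vector in the span of at most [n + 1] vectors of different colors
has one of their colors ([in_span_colors]). One vector of each color gives
[n + 3] vectors in dimension [n + 2], hence a linear relation, all of whose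
coefficients are nonzero ([color_reps_relation]).

If [n >= 3], two of the coefficients, at [b] and [c] say, have the same sign.
Then the [b, c] part [u] of the relation is timelike. Let [y] be the part of the
relation at two other colors [d] and [e]. The line through [u] and [y] meets
the cone in a null vector [v]. Its color is one of [b, c, d, e]; but the
relation also puts [v] in the span of the vectors of all colors but [d, e], and
in that of all colors but [b, c], a contradiction ([high_dimension]).

If [n = 2], this does not apply: five points are too few, and a circle argument
is needed ([dimension_two]). The relation can be used to find a circle with
three colors [C, D, E] and a circle with colors [A, B, D] that are tangent at a
point of color [D]. Sending this point to infinity turns them into two parallel
lines. Four points on these lines that form an isosceles trapezoid are
concyclic, so they do not have four colors. This forces both colorings to have
many symmetries, and in the end the translation that takes a point of color [C]
on the first line to a point of color [E] swaps the colors [C] and [E] on the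
whole line, and fixes [D] ([two_rows_swap], [tangent_circles_swap]). The same
symmetries produce a third circle, tangent to the first at the point of color
[C], so that [D] and [E] are swapped by a parabolic map fixing that point. In the
coordinate [t] on the first circle in which the chosen points of colors
[C, E, D] are [0, 1, oo], the two maps are [t |-> t + 1] and [1/t |-> 1/t + 1]. The
golden ratio [x = 1 + 1/x] is the image of [1/x] under the first map, and [1/x]
is the image of [x] under the second map. Hence the color of [1/x] is fixed by
the composition of two different transpositions of [C, D, E], a cycle without
fixed points ([no_tangent_circles]). *)

(** * Preliminaries *)

Lemma extend_set (T : finType) (S : {set T}) (k : nat) :
  (#|S| <= k <= #|T|)%N -> exists2 J : {set T}, S \subset J & #|J| = k.
Proof.
elim: k => [|k IH] /andP[Sk kT].
  by exists S => //; apply/eqP; rewrite -leqn0.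
move: Sk; rewrite leq_eqVlt => /orP[/eqP Sk|]; first by exists S.
rewrite ltnS => Sk; have [|J SJ Jk] := IH; first by rewrite Sk ltnW.
have : (0 < #|~: J|)%N by rewrite cardsCs finset.setCK Jk subn_gt0.
case/card_gt0P => x; rewrite inE => xJ.
by exists (x |: J); [rewrite subsetU // SJ orbT | rewrite cardsU1 xJ Jk].
Qed.

Lemma opposite_signs (R : realDomainType) (x y z : R) :
  x * y < 0 -> x * z < 0 -> 0 < y * z.
Proof.
move=> xy xz; have x2 : 0 < x ^+ 2.
  by rewrite lt_neqAle sqr_ge0 eq_sym expf_neq0 //; apply: contraTneq xy => ->;
    rewrite mul0r ltxx.
have : 0 < (x * y) * (x * z) by rewrite nmulr_rgt0.
by rewrite mulrACA -expr2 pmulr_rgt0.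
Qed.

Lemma quadratic_root (R : rcfType) (a b c : R) : a != 0 -> 0 <= b ^+ 2 - a * c ->
  exists x, a * x ^+ 2 + 2 * b * x + c = 0.
Proof.
move=> a0 D; exists ((- b + Num.sqrt (b ^+ 2 - a * c)) / a).
have := sqr_sqrtr D; set z := Num.sqrt _ => z2.
have -> : a * ((- b + z) / a) ^+ 2 + 2 * b * ((- b + z) / a) + c =
   (z ^+ 2 - (b ^+ 2 - a * c)) / a by field.
by rewrite z2 subrr mul0r.
Qed.

Lemma golden_ratio (R : realType) :
  exists2 x : R, x != 0 & x^-1 = x - 1 /\ (x - 1)^-1 = x.
Proof.
pose s : R := Num.sqrt 5; have s2 : s ^+ 2 = 5 by rewrite sqr_sqrtr ?ler0n.
pose x := (1 + s) / 2; have xx : x * (x - 1) = 1.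
  have -> : x * (x - 1) = (s ^+ 2 - 1) / 4 by rewrite /x; field.
  by rewrite s2; field.
have x0 : x != 0.
  by apply: contra_eq_neq xx => ->; rewrite mul0r eq_sym oner_neq0.
have xV : x^-1 = x - 1 by apply: (mulfI x0); rewrite mulfV.
by exists x => //; split; rewrite // -xV invrK.
Qed.

(** * Swapping colors along two parallel lines *)

Definition swap (T : eqType) (x y z : T) :=
  if z == x then y else if z == y then x else z.

(** The composition of two transpositions of three colors is a 3-cycle. *)
Lemma swap_swap_neq (T : eqType) (C D E X : T) :
  uniq [:: C; D; E] -> X \in [:: C; D; E] ->
  X != swap D E (swap C E X).
Proof.
rewrite /= !inE !negb_or andbT => /andP[/andP[CD CE] DE].
have neqs : ((C == D) = false) * ((C == E) = false) * ((D == E) = false)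
    * ((D == C) = false) * ((E == C) = false) * ((E == D) = false).
  by do !split; apply/negbTE; rewrite // eq_sym.
by case/or3P=> /eqP ->; rewrite /swap; do !rewrite !(eqxx, neqs).
Qed.

(** [f] and [g] are the colorings of two parallel lines. Reflecting in the middle
of a [C]-point and an [E]-point of the first line preserves [g], and reflecting
in the middle of an [A]-point and a [B]-point of the second preserves [f]. So a
translation that preserves [g] moves [A]-points to [A]-points, and composing two
reflections of the second kind shows that it preserves [f] as well. Composing
two reflections of the first kind gives such translations: by [t] if [f t = C],
by [t - e] if [f t = E]; this makes [e + e] a period of [f]. *)
Lemma two_rows_swap (V : comNzRingType) (T : eqType) (f g : V -> T)
    (A B C D E : T) (e a b : V) :
  f 0 = C -> f e = E -> g a = A -> g b = B ->
  (forall t, f t \in [:: C; D; E]) ->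
  (forall x y s, f x = C -> f y = E -> g (x + y - s) = g s) ->
  (forall x y t, g x = A -> g y = B -> f (x + y - t) = f t) ->
  (forall t, f (t + e) = swap C E (f t)) /\ g (- b) = A.
Proof.
move=> f0 fe ga gb f_cde gsym fsym.
have per t : (forall s, g (s + t) = g s) -> forall u, f (u + t) = f u.
  move=> gt u; rewrite -[RHS](fsym a b u) // -(fsym (a + t) b) ?gt //.
  by congr f; ring.
(* Compose the reflections of the second line given by [0, e] and by [t, e]. *)
have gperC t : f t = C -> forall s, g (s + t) = g s.
  move=> ft s; rewrite -[RHS](gsym 0 e s) // -[RHS](gsym t e) //.
  by congr g; ring.
(* Compose the reflections of the second line given by [0, e] and by [0, t]. *)
have gperE t : f t = E -> forall s, g (s + (t - e)) = g s.
  move=> ft s; rewrite -[RHS](gsym 0 e s) // -[RHS](gsym 0 t) //.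
  by congr g; ring.
have fab : f (a + b) = C by rewrite -f0 -(fsym a b 0) // subr0.
have fabe : f (a + b - e) = E by rewrite fsym.
(* [e + e] is the difference of the two periods [a + b] and [a + b - e - e]. *)
have f2e u : f (u + (e + e)) = f u.
  rewrite -(per _ (gperE _ fabe)) -[RHS](per _ (gperC _ fab)).
  by congr f; ring.
have CtoE t : f t = C -> f (t + e) = E.
  by move=> ft; rewrite addrC (per _ (gperC _ ft)).
have EtoC t : f t = E -> f (t + e) = C.
  move=> ft; rewrite -f0 -(f2e 0) -[RHS](per _ (gperE _ ft)).
  by congr f; ring.
split=> [t|]; last first.
  by rewrite -ga -(gperC _ fab (- b)); congr g; ring.
rewrite /swap; have [/CtoE //|/eqP ftC] := eqVneq (f t) C.
have [/EtoC //|/eqP ftE] := eqVneq (f t) E.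
have ft2 : f (t + e + e) = f t by rewrite -addrA f2e.
have := f_cde (t + e); have := f_cde t; rewrite !inE.
move/or3P => [/eqP //|/eqP ->|/eqP //].
by move/or3P => [/eqP/CtoE|/eqP //|/eqP/EtoC]; rewrite ft2.
Qed.

(** * The Lorentzian form *)

Section Minkowski.
Variables (R : realType) (m : nat).
Local Notation V := 'rV[R]_(1 + m).
Implicit Types u v w : V.

Definition time v : R := lsubmx v 0 0.

Definition mink v w : R :=
  \sum_i rsubmx v 0 i * rsubmx w 0 i - time v * time w.

Definition null v := v != 0 /\ mink v v = 0.

Lemma minkC v w : mink v w = mink w v.
Proof.
rewrite /mink (mulrC (time v)); congr (_ + _).
by apply: eq_bigr => i _; rewrite mulrC.
Qed.

Lemma minkDl u v w : mink (u + v) w = mink u w + mink v w.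
Proof.
rewrite /mink /time !mxE mulrDl opprD addrACA -big_split /=.
by congr (_ + _); apply: eq_bigr => i _; rewrite !mxE mulrDl.
Qed.

Lemma minkZl a v w : mink (a *: v) w = a * mink v w.
Proof.
rewrite /mink /time !mxE mulrBr mulr_sumr mulrA.
by congr (_ + _); apply: eq_bigr => i _; rewrite !mxE mulrA.
Qed.

Lemma minkDr u v w : mink w (u + v) = mink w u + mink w v.
Proof. by rewrite minkC minkDl !(minkC w). Qed.

Lemma minkZr a v w : mink w (a *: v) = a * mink w v.
Proof. by rewrite minkC minkZl minkC. Qed.

Lemma minkNl v w : mink (- v) w = - mink v w.
Proof. by rewrite -scaleN1r minkZl mulN1r. Qed.

Lemma minkNr v w : mink w (- v) = - mink w v.
Proof. by rewrite minkC minkNl minkC. Qed.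

Lemma mink0l w : mink 0 w = 0.
Proof. by rewrite -(scale0r 0) minkZl mul0r. Qed.

Definition minkE := (minkDl, minkDr, minkZl, minkZr, minkNl, minkNr).

End Minkowski.

(** * Tangent circles *)

Section Circles.
Variables (R : realType) (m : nat) (T : eqType).
Local Notation V := 'rV[R]_(1 + m).
Variable color : V -> T.

Hypothesis colorZ : forall (a : R) v, a != 0 -> color (a *: v) = color v.
Hypothesis color_sep :
  forall v w, null v -> null w -> color v <> color w -> mink v w != 0.
Hypothesis rainbow_free : forall v1 v2 v3 v4 (c1 c2 c3 c4 : R),
  null v1 -> null v2 -> null v3 -> null v4 ->
  uniq [:: color v1; color v2; color v3; color v4] ->
  c1 *: v1 + c2 *: v2 + c3 *: v3 + c4 *: v4 = 0 -> c1 = 0.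

(** The frame of a parametrized circle: by [circle_pt_null], the parabola
[t |-> t^2 p + t q + c] lies on the cone. It is a circle through [p] (at
[t = oo]) and [c] (at [t = 0]). Two frames with the same [p] and [q] describe
circles that are tangent at [p], seen from [p] as parallel lines with the same
unit of length. *)
Definition circle_frame (p q c : V) :=
  [/\ null p, null c & mink p c != 0] /\
  [/\ mink p q = 0, mink c q = 0 & mink q q = - 2 * mink p c].

Definition circle_pt (p q c : V) (t : R) : V := t ^+ 2 *: p + t *: q + c.

Lemma circle_pt_null p q c t : circle_frame p q c -> null (circle_pt p q c t).
Proof.
case=> [[[_ pp] [_ cc] pc] [pq cq qq]]; split; last first.
  rewrite !minkE pp cc qq (minkC q p) (minkC q c) pq cq (minkC c p); ring.
apply: contraNneq pc => k0; have := mink0l p; rewrite -k0 !minkE pp.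
by rewrite (minkC q) pq (minkC c) !mulr0 !add0r => ->.
Qed.

(** The inversion [t |-> 1/t] of the parameter. *)
Lemma circle_frame_sym p q c : circle_frame p q c -> circle_frame c q p.
Proof.
by case=> [[np nc pc] [pq cq qq]]; split; split=> //; rewrite minkC // qq minkC.
Qed.

(** The points [x], [y] of the first circle and [s], [s'] of the second are
coplanar if [x + y = s + s'], as the differences of the two pairs are then
multiples of the same vector [(x + y) p + q]. This gives the symmetries needed
for [two_rows_swap]. *)
Lemma tangent_circles_swap p q c c' (A B C D E : T) (a b : R) :
  circle_frame p q c -> circle_frame p q c' -> uniq [:: A; B; C; D; E] ->
  color p = D -> color c = C -> color (circle_pt p q c 1) = E ->
  color (circle_pt p q c' a) = A -> color (circle_pt p q c' b) = B ->
  [/\ forall t, color (circle_pt p q c t) \in [:: C; D; E],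
      forall t, color (circle_pt p q c (t + 1)) = swap C E (color (circle_pt p q c t))
    & color (circle_pt p q c' (- b)) = A].
Proof.
move=> Fc Fc' Hu pD cC eE aA bB.
set f := fun t => color (circle_pt p q c t).
set g := fun t => color (circle_pt p q c' t).
have nf t : null (circle_pt p q c t) by exact: circle_pt_null.
have ng t : null (circle_pt p q c' t) by exact: circle_pt_null.
have np : null p by case: Fc => -[].
have f0 : f 0 = C.
  by rewrite /f /circle_pt expr0n /= !scale0r !add0r.
have ab : a - b != 0.
  apply: contraTneq Hu => /subr0_eq E'; rewrite -aA -bB E' /=.
  by rewrite inE eqxx.
have f_in t : f t \in [:: C; D; E].
  apply/negP => /negP Ht.
  suff: (1 : R) = 0 by move/eqP; rewrite oner_eq0.
  apply: (@rainbow_free (circle_pt p q c t) (circle_pt p q c 0)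
     (circle_pt p q c 1) p _ (t - 1) (- t) (t - t ^+ 2)) => //.
    move: Ht Hu; rewrite -/(f t) -/(f 0) f0 eE pD /= !inE !negb_or.
    move=> /and3P[h1 h2 h3] /and5P[_ _ /andP[h4 h5] h6 _].
    by rewrite h1 h2 h3 h4 h5 eq_sym h6.
  by apply/rowP => i; rewrite !mxE; ring.
have g_in t : g t \in [:: A; B; D].
  apply/negP => /negP Ht; move/negP: ab; apply; apply/eqP.
  apply: (@rainbow_free (circle_pt p q c' t) (circle_pt p q c' a)
     (circle_pt p q c' b) p _ (b - t) (t - a)
     (- ((a - b) * t ^+ 2 + (b - t) * a ^+ 2 + (t - a) * b ^+ 2))) => //.
    move: Ht Hu; rewrite -/(g t) aA bB pD /= !inE !negb_or.
    move=> /and3P[h1 h2 h3] /and5P[/and4P[h4 _ h5 _] /and3P[_ h6 _] _ _ _].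
    by rewrite h1 h2 h3 h4 h5 h6.
  by apply/rowP => i; rewrite !mxE; ring.
have trap x y s s' : x + y = s + s' -> uniq [:: f x; f y; g s; g s'] -> False.
  move=> xys Huq.
  have xy : x != y by apply: contraTneq Huq => ->; rewrite /= inE eqxx.
  have ss : s - s' = 0.
    apply: (@rainbow_free (circle_pt p q c x) (circle_pt p q c y)
     (circle_pt p q c' s) (circle_pt p q c' s') _ (s' - s) (y - x) (x - y)) => //.
    have -> : x = s + s' - y by rewrite -xys; ring.
    by apply/rowP => i; rewrite !mxE; ring.
  by move: Huq; rewrite (subr0_eq ss) /= !inE eqxx /= !andbF.
have neqs : ((C == E) = false) * ((C == A) = false) * ((C == B) = false)
    * ((C == D) = false) * ((E == A) = false) * ((E == B) = false)
    * ((E == D) = false) * ((A == B) = false) * ((A == C) = false)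
    * ((A == D) = false) * ((A == E) = false) * ((B == C) = false)
    * ((B == D) = false) * ((B == E) = false).
  move: Hu; rewrite /= !inE !negb_or.
  case/and5P=> /and4P[h1 h2 h3 h4] /and3P[h5 h6 h7] /andP[h8 h9] h10 _.
  by do !split; apply/negbTE; rewrite // eq_sym.
have gsym x y s : f x = C -> f y = E -> g (x + y - s) = g s.
  move=> fx fy; apply/eqP/negP => /negP gne.
  apply: (trap x y (x + y - s) s); first by ring.
  move: gne (g_in s) (g_in (x + y - s)); rewrite fx fy !inE.
  move: (g s) (g (x + y - s)) => u v vu /or3P uE /or3P vE.
  case: uE vu => /eqP ->; case: vE => /eqP -> vu; rewrite ?eqxx // in vu *;
    by rewrite /= !inE !neqs ?vu.
have fsym x y t : g x = A -> g y = B -> f (x + y - t) = f t.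
  move=> gx gy; apply/eqP/negP => /negP fne.
  apply: (trap (x + y - t) t x y); first by ring.
  move: fne (f_in t) (f_in (x + y - t)); rewrite gx gy !inE.
  move: (f t) (f (x + y - t)) => u v vu /or3P uE /or3P vE.
  case: uE vu => /eqP ->; case: vE => /eqP -> vu; rewrite ?eqxx // in vu *;
    by rewrite /= !inE ?vu ?(eq_sym D) ?(eq_sym E C) ?neqs.
by case: (two_rows_swap f0 eE aA bB f_in gsym fsym).
Qed.


(** Besides the given pair of circles, tangent at [p], the circle through [c] and
the points [b] and [- b] of the second circle is tangent to the first one at
[c]; by [tangent_circles_swap] its colors are [A], [B] and [C]. So the same
lemma applies again, with [p] and [c] exchanged, and the two resulting color
swaps contradict each other at the golden ratio. *)
Lemma no_tangent_circles p q c c' (A B C D E : T) (a b : R) :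
  circle_frame p q c -> circle_frame p q c' -> uniq [:: A; B; C; D; E] ->
  color p = D -> color c = C -> color (circle_pt p q c 1) = E ->
  color (circle_pt p q c' a) = A -> color (circle_pt p q c' b) = B -> False.
Proof.
move=> Fc Fc' Hu pD cC eE aA bB.
have [f_in f_swap bA] := tangent_circles_swap Fc Fc' Hu pD cC eE aA bB.
have h1 : mink c (circle_pt p q c' b) != 0.
  have BC : color c <> color (circle_pt p q c' b).
    by rewrite cC bB => BC; move: Hu; rewrite BC /= !inE eqxx /= andbF.
  apply: (color_sep _ (circle_pt_null _ Fc')) BC.
  by case: Fc => -[].
(* The factor [mu] gives the new frame the same unit of length as the old one;
   [b] and [- b] become the parameters [mu * b] and [mu * - b]. *)
set mu := mink p c / mink c (circle_pt p q c' b).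
have pc : mink p c != 0 by case: Fc => -[].
have mu0 : mu != 0 by rewrite mulf_neq0 ?invr_neq0.
pose w := mu *: (b ^+ 2 *: p + c') - (mu ^+ 2 * b ^+ 2) *: c.
have wpt t : t ^+ 2 = b ^+ 2 -> circle_pt c q w (mu * t) = mu *: circle_pt p q c' t.
  by move=> tb; apply/rowP => i; rewrite !mxE exprMn tb; ring.
have cw : mink c w = mink p c.
  case: (Fc) (Fc') => [[_ [_ cc] _] [pq cq qq]] [[_ _ _] [_ cq' qq']].
  have -> : mink c w = mu * mink c (circle_pt p q c' b).
    by rewrite !minkE cc cq; ring.
  by rewrite /mu divfK.
have Fw : circle_frame c q w.
  case: (Fc) (Fc') => [[[_ pp] [c0 cc] _] [pq cq qq]] [[_ [_ cc'] _] [_ cq' qq']].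
  have wq : mink w q = 0 by rewrite !minkE pq cq cq'; ring.
  have pc' : mink p c' = mink p c by lra.
  split; split; rewrite ?cw //.
  split; first by apply: contraNneq pc => w0; rewrite -cw w0 minkC mink0l.
  have E1 : mink w w = 2 * mu * (mu * (b ^+ 2 * mink p c')
      - mu * b ^+ 2 * mink c w).
    rewrite [in RHS]/w !minkE pp cc cc' (minkC c' p) (minkC c p) (minkC c c'); ring.
  by rewrite E1 cw pc'; ring.
have Hu' : uniq [:: A; B; D; C; E].
  by apply: etrans Hu; apply: perm_uniq; apply/permP => P /=; ring.
have pt_inv t : t != 0 -> color (circle_pt c q p t) = color (circle_pt p q c t^-1).
  move=> t0; have -> : circle_pt c q p t = t ^+ 2 *: circle_pt p q c t^-1.
    by apply/rowP => i; rewrite !mxE; field.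
  by rewrite colorZ // expf_neq0.
have e1 : color (circle_pt c q p 1) = E by rewrite pt_inv ?oner_neq0 // invr1.
have a1 : color (circle_pt c q w (mu * - b)) = A by rewrite wpt ?sqrrN // colorZ.
have b1 : color (circle_pt c q w (mu * b)) = B by rewrite wpt // colorZ.
have [_ g_swap _] :=
  tangent_circles_swap (circle_frame_sym Fc) Fw Hu' cC pD e1 a1 b1.
have [x x0 [xV xV1]] := golden_ratio R.
have x10 : x - 1 != 0 by rewrite -xV invr_neq0.
have := g_swap (x - 1); rewrite subrK !pt_inv // xV xV1.
have := f_swap (x - 1); rewrite subrK => -> /eqP; apply/negP.
apply: swap_swap_neq => //.
by apply: subseq_uniq Hu; apply: (@suffix_subseq _ [:: A; B] [:: C; D; E]).
Qed.

(** The five vectors are scaled as in the stereographic projection from [d]: the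
differences of the four others are then orthogonal to [d], and the hypothesis on
[b - a] says that the lines [a b] and [c e] of the projection are parallel. *)
Lemma no_normalized_tangency d c e a b (x y : R) :
  null d -> null c -> null e -> null a -> null b ->
  uniq [:: color a; color b; color c; color d; color e] ->
  mink d c = 1 -> mink d e = 1 -> mink d a = 1 -> mink d b = 1 ->
  b = a + y *: (e - c) + x *: d -> False.
Proof.
move=> nd nc ne na nb Hu dc de da db bE.
have dd : mink d d = 0 by case: nd.
have cc : mink c c = 0 by case: nc.
have ee : mink e e = 0 by case: ne.
have aa : mink a a = 0 by case: na.
have bb : mink b b = 0 by case: nb.
have k0 : mink e c != 0.
  apply: color_sep => // ec; move: Hu; rewrite ec /= !inE eqxx /=.
  by rewrite !orbT !andbF.
set k := mink e c in k0 *.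
have [p pE] : {p | p = k *: d} by exists (k *: d).
have [q qE] : {q | q = e - c - p} by exists (e - c - p).
have pp : mink p p = 0 by rewrite pE !minkE dd; ring.
have pc : mink p c = k by rewrite pE !minkE dc; ring.
have pq : mink p q = 0 by rewrite qE pE !minkE dd dc de; ring.
have cq : mink c q = 0.
  by rewrite qE pE !minkE cc (minkC c d) dc (minkC c e) -/k; ring.
have qq : mink q q = - 2 * k.
  rewrite qE pE !minkE cc dd ee (minkC c d) (minkC c e) (minkC e d) dc de -/k; ring.
have np : null p.
  by split=> //; apply: contraNneq k0 => p0; rewrite -pc p0 mink0l.
have Fc : circle_frame p q c by split; split; rewrite ?pc.
(* The parameter of [a] on the second circle, from [mink c' q = 0]. *)
pose s := - mink q a / (2 * k).
have qa : mink q a = - 2 * s * k by rewrite /s; field.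
have [c' c'E] : {c' | c' = a - s *: q - s ^+ 2 *: p}.
  by exists (a - s *: q - s ^+ 2 *: p).
have pa : mink p a = k by rewrite pE minkZl da mulr1.
have pc' : mink p c' = k by rewrite c'E !(minkDr, minkNr, minkZr) pa pq pp; ring.
have c'q : mink c' q = 0.
  rewrite c'E !(minkDl, minkNl, minkZl) (minkC a) qa qq pq; ring.
have c'c' : mink c' c' = 0.
  rewrite {2}c'E !(minkDr, minkNr, minkZr) c'q (minkC c' p) pc'.
  rewrite c'E !(minkDl, minkNl, minkZl) aa qa pa; ring.
have Fc' : circle_frame p q c'.
  split; split; rewrite ?pc' //; split => //.
  by apply: contraNneq k0 => c0; rewrite -pc' c0 minkC mink0l.
have Ea : circle_pt p q c' s = a.
  by rewrite c'E; apply/rowP => i; rewrite !mxE; ring.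
have bE' : b = a + y *: q + (x + y * k) *: d.
  by rewrite bE qE pE; apply/rowP => i; rewrite !mxE; ring.
have xE : x + y * k = (2 * s * y + y ^+ 2) * k.
  move: bb; rewrite {1}bE' !(minkDl, minkZl) db.
  have -> : mink a b = - 2 * s * k * y + (x + y * k).
    by rewrite {1}bE' !(minkDr, minkZr) aa (minkC a q) qa (minkC a d) da; ring.
  have -> : mink q b = - 2 * s * k - 2 * k * y.
    rewrite {1}bE' !(minkDr, minkZr) qa qq.
    have -> : mink q d = 0.
      move/eqP: pq; rewrite pE minkZl mulf_eq0 (negbTE k0) minkC.
      by move/eqP.
    by ring.
  lra.
have Eb : circle_pt p q c' (s + y) = b.
  by rewrite bE' xE c'E pE; apply/rowP => i; rewrite !mxE; ring.
apply: (no_tangent_circles (a := s) (b := s + y) Fc Fc' Hu); rewrite ?Ea ?Eb //.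
  by rewrite pE colorZ.
by congr color; rewrite qE; apply/rowP => i; rewrite !mxE; ring.
Qed.

(** The hypotheses say that the line [a b] meets the plane of the circle
[c d e] in a point of the tangent at [d], that is, that the circles [a b d] and
[c d e] are tangent at [d]. *)
Lemma no_tangency d c e a b (al be xi ga ep : R) :
  null d -> null c -> null e -> null a -> null b ->
  uniq [:: color a; color b; color c; color d; color e] -> al != 0 ->
  al *: a + be *: b = xi *: d + ga *: c + ep *: e ->
  mink (al *: a + be *: b) d = 0 -> False.
Proof.
move=> nd nc ne na nb Hu al0 Erel Pd.
have nZ l v : l != 0 -> null v -> null (l *: v).
  move=> l0 [v0 vv]; split; first by rewrite scaler_eq0 negb_or l0.
  by rewrite !minkE vv !mulr0.
have [ab0 [bd0 [cd0 ed0]]] : mink d a != 0 /\ mink d b != 0 /\ mink d c != 0 /\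
    mink d e != 0.
  move: Hu; rewrite /= !inE !negb_or.
  case/and5P=> /and4P[_ _ h3 _] /and3P[_ h6 _] /andP[h8 _] h10 _.
  by do !split; apply: color_sep => //; apply/eqP; rewrite // eq_sym.
set la := mink d a in ab0; set lb := mink d b in bd0; set lc := mink d c in cd0.
set le := mink d e in ed0.
have lab : be * lb = - (al * la).
  by move: Pd; rewrite !minkE !(minkC _ d) -/la -/lb; lra.
have dd : mink d d = 0 by case: nd.
have gaep : ga * lc = - (ep * le).
  move: Pd; rewrite Erel !minkE !(minkC _ d) dd -/lc -/le; lra.
have be0 : be != 0.
  by apply: contraTneq ab0 => b0; move: lab; rewrite b0 mul0r => /eqP;
    rewrite eq_sym oppr_eq0 mulf_eq0 (negbTE al0) negbK.
apply: (@no_normalized_tangency d (lc^-1 *: c) (le^-1 *: e) (la^-1 *: a)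
   (lb^-1 *: b) (- xi / (al * la)) (- (ep * le) / (al * la))) => //;
  rewrite ?colorZ ?invr_eq0 //; try (by apply: nZ; rewrite ?invr_eq0);
  rewrite ?minkZr ?mulVf //.
have -> : b = be^-1 *: (xi *: d + ga *: c + ep *: e - al *: a).
  by rewrite -Erel addrAC subrr add0r scalerA mulVf // scale1r.
have gaE : ga = - (ep * le) / lc by rewrite -gaep mulfK.
have beE : be = - (al * la) / lb by rewrite -lab mulfK.
apply/rowP => i; rewrite !mxE gaE beE; field.
by rewrite al0 ab0 bd0 cd0 ed0.
Qed.

End Circles.

(** * Independence of vectors of different colors *)

Section Coloring.
Variables (R : realType) (N : nat).
Local Notation V := 'rV[R]_(1 + N).
Local Notation T := 'I_N.+2.
Variable G : 'rV[R]_N -> T.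
Implicit Types (u v w : V).

Definition homog (x : 'rV[R]_N) : V := row_mx 1%:M x.
Definition sphere_pt (v : V) : 'rV[R]_N := (time v)^-1 *: rsubmx v.
Definition color (v : V) : T := G (sphere_pt v).
Definition unit_vec (x : 'rV[R]_N) := \sum_i x 0 i ^+ 2 = 1.

Lemma time_homog (x : 'rV[R]_N) : time (homog x) = 1.
Proof. by rewrite /time row_mxKl mxE. Qed.

Lemma sphere_pt_homog (x : 'rV[R]_N) : sphere_pt (homog x) = x.
Proof. by rewrite /sphere_pt time_homog row_mxKr invr1 scale1r. Qed.

Lemma homog_null (x : 'rV[R]_N) : unit_vec x -> null (homog x).
Proof.
move=> x1; split.
  apply/eqP => x0; have := time_homog x; rewrite x0 /time !mxE => /eqP.
  by rewrite eq_sym oner_eq0.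
rewrite /mink time_homog row_mxKr mulr1.
by under eq_bigr do rewrite -expr2; rewrite x1 subrr.
Qed.

Lemma dot_lt1 (x y : 'rV[R]_N) : unit_vec x -> unit_vec y -> x != y ->
  \sum_i x 0 i * y 0 i < 1.
Proof.
move=> x1 y1 xy; have : 0 < \sum_i (x 0 i - y 0 i) ^+ 2.
  have h i : true -> 0 <= (x 0 i - y 0 i) ^+ 2 by move=> _; exact: sqr_ge0.
  rewrite lt_neqAle sumr_ge0 // andbT eq_sym psumr_neq0 //.
  have [i xyi] : exists i, x 0 i != y 0 i.
    apply/existsP; apply: contraNT xy => /existsPn xy; apply/eqP/rowP => i.
    by apply/eqP; have := xy i; rewrite negbK.
  apply/hasP; exists i; first by rewrite mem_index_enum.
  by rewrite lt_neqAle sqr_ge0 andbT eq_sym sqrf_eq0 subr_eq0.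
suff -> : \sum_i (x 0 i - y 0 i) ^+ 2 =
  \sum_i x 0 i ^+ 2 + \sum_i y 0 i ^+ 2 - 2 * \sum_i x 0 i * y 0 i.
  by rewrite x1 y1; lra.
rewrite mulr_sumr -big_split /= -sumrB; apply: eq_bigr => i _; ring.
Qed.

Lemma mink_lt0 (x y : 'rV[R]_N) : unit_vec x -> unit_vec y -> x != y ->
  mink (homog x) (homog y) < 0.
Proof.
move=> x1 y1 xy; rewrite /mink !time_homog !row_mxKr mulr1 subr_lt0.
exact: dot_lt1.
Qed.

Lemma null_time v : null v -> time v != 0.
Proof.
case=> v0 vv; apply: contraNneq v0 => t0; move: vv.
rewrite /mink t0 mulr0 subr0 => /eqP.
rewrite psumr_eq0 => [/allP h|i _]; last by rewrite -expr2 sqr_ge0.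
apply/eqP; rewrite -[v]hsubmxK.
have -> : lsubmx v = 0 by apply/matrixP => i j; rewrite !ord1 [RHS]mxE.
have -> : rsubmx v = 0.
  apply/rowP => i; have := h i (mem_index_enum i).
  by rewrite mulf_eq0 orbb => /eqP ->; rewrite [RHS]mxE.
by rewrite row_mx0.
Qed.

Lemma null_as_homog v : null v -> v = time v *: homog (sphere_pt v).
Proof.
move=> nv; rewrite /homog scale_row_mx /sphere_pt scalerA.
rewrite mulfV ?null_time // scale1r.
rewrite -[v in LHS]hsubmxK; congr row_mx.
by apply/matrixP => i j; rewrite !ord1 /time !mxE eqxx mulr1.
Qed.

Lemma null_unit v : null v -> unit_vec (sphere_pt v).
Proof.
move=> nv; have t0 := null_time nv; case: nv => _.
rewrite /mink /unit_vec => /eqP; rewrite subr_eq0 => /eqP vv.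
have -> : \sum_i sphere_pt v 0 i ^+ 2 =
    (time v) ^- 2 * \sum_i rsubmx v 0 i * rsubmx v 0 i.
  by rewrite mulr_sumr; apply: eq_bigr => i _; rewrite [sphere_pt v 0 i]mxE; field.
by rewrite vv; field.
Qed.

Lemma color_homog (x : 'rV[R]_N) : color (homog x) = G x.
Proof. by rewrite /color sphere_pt_homog. Qed.

Lemma colorZ (a : R) v : a != 0 -> color (a *: v) = color v.
Proof.
move=> a0; rewrite /color /sphere_pt /time; congr G; apply/rowP => i.
rewrite !mxE; set t := v 0 (lshift _ _).
have [->|t0] := eqVneq t 0; last by field; rewrite a0 t0.
by rewrite mulr0 invr0 !mul0r.
Qed.

Lemma color_sep v w : null v -> null w -> color v <> color w -> mink v w != 0.
Proof.
move=> nv nw vw; rewrite (null_as_homog nv) (null_as_homog nw) !minkE.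
rewrite !mulf_neq0 ?null_time // lt_eqF //.
by apply: mink_lt0;
  [exact: null_unit..|apply: contra_not_neq vw => e; rewrite /color e].
Qed.

Definition color_reps (s : T -> V) := forall i, null (s i) /\ color (s i) = i.

(* The hypothesis to be refuted: no hyperplane contains more than [N] colors. *)
Hypothesis few_colors : forall (a : 'cV[R]_(1 + N)) (J : {set T}) (s : T -> V),
  a != 0 -> color_reps s -> (forall i, i \in J -> s i *m a = 0) -> (#|J| <= N)%N.

Definition nonzero (c : T -> R) : {set T} := [set i | c i != 0].

(** A dependency between at most [N + 1] of the vectors would put [N + 1] of them
in a common hyperplane. *)
Lemma color_reps_indep (s : T -> V) (c : T -> R) : color_reps s ->
  (#|nonzero c| <= N.+1)%N -> \sum_i c i *: s i = 0 ->
  forall i, c i = 0.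
Proof.
move=> Ts cN c0 i0; apply/eqP; apply: contraTT isT => ci0.
have [|J SJ JN] := @extend_set _ (nonzero c) N.+1.
  by rewrite cN card_ord leqnSn.
pose M : 'M[R]_(#|J|, 1 + N) := \matrix_(i < #|J|) s (enum_val i).
pose cJ : 'rV[R]_#|J| := \row_i c (enum_val i).
have cM : cJ *m M = 0.
  have -> : cJ *m M = \sum_(i in J) c i *: s i.
    rewrite big_enum_val mulmx_sum_row.
    by apply: eq_bigr => i _; rewrite rowK mxE.
  rewrite -[RHS]c0 [RHS](bigID (mem J)) /=.
  rewrite [X in _ = _ + X]big1 ?addr0 // => i iJ.
  have : i \notin nonzero c by apply: contra iJ; apply/fintype.subsetP.
  by rewrite inE negbK => /eqP ->; rewrite scale0r.
have iJ : i0 \in J by apply: (fintype.subsetP SJ); rewrite inE.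
have cJ0 : cJ != 0.
  apply: contraNneq ci0 => cJ0; have /rowP/(_ (enum_rank_in iJ i0)) := cJ0.
  by rewrite !mxE enum_rankK_in // => ->.
have rM : (\rank M < 1 + N)%N.
  rewrite ltn_neqAle rank_leq_col andbT; apply: contra cJ0 => /eqP rM.
  have /row_freeP[M' MM'] : row_free M by rewrite /row_free rM JN.
  by rewrite -[cJ]mulmx1 -MM' mulmxA cM mul0mx.
have : kermx M^T != 0.
  by rewrite -mxrank_eq0 mxrank_ker mxrank_tr subn_eq0 -ltnNge.
case/rowV0Pn => a /sub_kermxP aM a0.
have : (#|J| <= N)%N; last by rewrite JN ltnn.
apply: (@few_colors a^T _ s) => // [|i Ji].
  by rewrite -(inj_eq trmx_inj) trmxK trmx0.
have Ma : M *m a^T = 0 by rewrite -[M]trmxK -trmx_mul aM trmx0.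
have -> : s i = row (enum_rank_in Ji i) M by rewrite rowK enum_rankK_in.
by rewrite -row_mul Ma row0.
Qed.

Definition override (s : T -> V) (v : V) i := if i == color v then v else s i.

Lemma override_color_reps s v : null v -> color_reps s ->
  color_reps (override s v).
Proof. by move=> nv Ts i; rewrite /override; case: eqP => [->|]. Qed.

(** Otherwise [v] could replace the representative of its color, which does not
occur in the combination, and would depend on at most [N] others. *)
Lemma span_colors (s : T -> V) (c : T -> R) (v : V) : color_reps s -> null v ->
  v = \sum_i c i *: s i -> (#|nonzero c| <= N)%N -> c (color v) != 0.
Proof.
move=> Ts nv vE cN; apply/eqP => cv0.
pose c' i := if i == color v then -1 else c i.
have : c' (color v) = 0.
  apply: (color_reps_indep (override_color_reps nv Ts)).
    apply: leq_trans (_ : #|color v |: nonzero c| <= _)%N.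
      apply: subset_leq_card; apply/fintype.subsetP => i; rewrite !inE /c'.
      by case: (i == color v).
    by rewrite cardsU1; apply: (leq_add (leq_b1 _) cN).
  rewrite (bigD1 (color v)) //= {1}/c' /override eqxx scaleN1r {1}vE.
  rewrite (bigD1 (color v)) //= cv0 scale0r add0r addrC.
  apply/eqP; rewrite subr_eq0; apply/eqP/eq_bigr => i /negbTE iv.
  by rewrite /c' iv.
by rewrite /c' eqxx => /eqP; rewrite oppr_eq0 oner_eq0.
Qed.

(** The coefficient function of a linear combination that is given as a list of
colors with coefficients. *)
Definition combo (r : seq (T * R)) (i : T) : R :=
  \sum_(p <- r) (if p.1 == i then p.2 else 0).

Lemma combo_cons j x r i :
  combo ((j, x) :: r) i = (if j == i then x else 0) + combo r i.
Proof. by rewrite /combo big_cons. Qed.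

Lemma combo_nil i : combo [::] i = 0.
Proof. by rewrite /combo big_nil. Qed.

Lemma combo_sum r (s : T -> V) :
  \sum_i combo r i *: s i = \sum_(p <- r) p.2 *: s p.1.
Proof.
under eq_bigr do rewrite scaler_suml; rewrite exchange_big /=.
apply: eq_bigr => p _; rewrite (bigD1 p.1) //= eqxx big1 ?addr0 // => i.
by rewrite eq_sym => /negbTE ->; rewrite scale0r.
Qed.

Lemma combo_out r i : i \notin map fst r -> combo r i = 0.
Proof.
move=> ir; rewrite /combo big_seq big1 // => p pr; case: eqP => // pi.
by case/negP: ir; rewrite -pi map_f.
Qed.

Lemma combo_supp r : (#|nonzero (combo r)| <= size r)%N.
Proof.
rewrite -(size_map fst); apply: leq_trans (card_size _).
apply/subset_leq_card/fintype.subsetP => i; rewrite inE.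
by apply: contraNT => /combo_out ->.
Qed.

Lemma in_span_colors r (s : T -> V) (v : V) : color_reps s -> null v ->
  (size r <= N)%N -> v = \sum_(p <- r) p.2 *: s p.1 -> color v \in map fst r.
Proof.
move=> Ts nv rN; rewrite -combo_sum => vE.
have := span_colors Ts nv vE (leq_trans (combo_supp r) rN).
by apply: contraNT => /combo_out ->.
Qed.

Lemma rainbow_independent (s : T -> V) (v1 v2 v3 v4 : V) (c1 c2 c3 c4 : R) :
  (3 <= N)%N -> color_reps s -> null v1 -> null v2 -> null v3 -> null v4 ->
  uniq [:: color v1; color v2; color v3; color v4] ->
  c1 *: v1 + c2 *: v2 + c3 *: v3 + c4 *: v4 = 0 -> c1 = 0.
Proof.
move=> N3 Ts n1 n2 n3 n4 Hu cv.
pose s' := override (override (override (override s v4) v3) v2) v1.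
have Ts' : color_reps s' by do !apply: override_color_reps.
pose r := [:: (color v1, c1); (color v2, c2); (color v3, c3); (color v4, c4)].
move: Hu; rewrite /= !inE !negb_or.
case/and4P=> /and3P[h12 h13 h14] /andP[h23 h24] h34 _.
have -> : c1 = combo r (color v1).
  rewrite !combo_cons combo_nil eqxx !(eq_sym _ (color v1)).
  by rewrite (negbTE h12) (negbTE h13) (negbTE h14) !addr0.
apply: (color_reps_indep Ts'); first exact: leq_trans (combo_supp r) _.
rewrite combo_sum !big_cons big_nil /= -[RHS]cv addr0 !addrA /s' /override.
rewrite !(eq_sym _ (color v1)) (negbTE h12) (negbTE h13) (negbTE h14).
rewrite !(eq_sym _ (color v2)) (negbTE h23) (negbTE h24).
by rewrite (eq_sym _ (color v3)) (negbTE h34) !eqxx.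
Qed.

(** There is one color more than the dimension; a vanishing coefficient would
leave a dependency between [N + 1] vectors. *)
Lemma color_reps_relation (s : T -> V) : color_reps s ->
  exists2 c : T -> R, (forall i, c i != 0) & \sum_i c i *: s i = 0.
Proof.
move=> Ts; pose M : 'M[R]_(N.+2, 1 + N) := \matrix_i s i.
have : kermx M != 0.
  rewrite -mxrank_eq0 mxrank_ker subn_eq0 -ltnNge ltnS.
  exact: rank_leq_col.
case/rowV0Pn => c /sub_kermxP cM c0; exists (fun i => c 0 i).
  move=> i; apply: contraNneq c0 => ci.
  apply/eqP/rowP => j; rewrite mxE.
  apply: (color_reps_indep (c := fun j => c 0 j) Ts).
    apply: (@leq_trans #|[set~ i]%SET|); last by rewrite cardsC1 card_ord.
    apply/subset_leq_card/fintype.subsetP => k; rewrite !inE.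
    by apply: contraNneq => ->; rewrite ci.
  by rewrite -[RHS]cM mulmx_sum_row; apply: eq_bigr => k _; rewrite rowK.
by rewrite -[RHS]cM mulmx_sum_row; apply: eq_bigr => k _; rewrite rowK.
Qed.

Lemma exists_notin (r : seq T) : (size r < N.+2)%N -> exists i, i \notin r.
Proof.
move=> rN; apply/existsP; apply: contraLR rN => /existsPn r_all.
rewrite -leqNgt; have : (#|{: T}| <= size r)%N; last by rewrite card_ord.
apply: leq_trans (card_size r).
apply/subset_leq_card/fintype.subsetP => i _.
by have := r_all i; rewrite negbK.
Qed.

(** * Spheres of dimension at least three *)

(** The form is positive semidefinite on the vectors of time [0], and modulo [u],
which is timelike, [y] may be assumed to be one of them. *)
Lemma line_meets_cone (u y : V) : mink u u < 0 ->
  exists r, mink (r *: u + y) (r *: u + y) = 0.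
Proof.
move=> uu.
have space_ge0 v : 0 <= \sum_i rsubmx v 0 i * rsubmx v 0 i.
  by apply: sumr_ge0 => i _; rewrite -expr2 sqr_ge0.
have tu : time u != 0.
  by apply: contraTneq uu => tu; rewrite /mink tu mulr0 subr0 -leNgt.
pose z := y - (time y / time u) *: u.
have tz : time z = 0.
  by rewrite /z /time !mxE; move: tu; rewrite /time mxE => tu; field.
have zz : 0 <= mink z z by rewrite /mink tz mulr0 subr0.
have [||r rE] := @quadratic_root _ (mink u u) (mink u z) (mink z z).
- by rewrite lt_eqF.
- by rewrite addr_ge0 ?sqr_ge0 // -mulNr mulr_ge0 // oppr_ge0 ltW.
exists (r - time y / time u).
have -> : (r - time y / time u) *: u + y = r *: u + z.
  by rewrite scalerBl addrAC -addrA.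
by rewrite -rE; move: (z) => w; rewrite !minkE (minkC w u); ring.
Qed.

Lemma pair_same_sign (c : T -> R) : (1 <= N)%N -> (forall i, c i != 0) ->
  exists i j, i != j /\ 0 < c i * c j.
Proof.
move=> N1 c0.
have [i _] : exists i : T, i \notin [::] by exact: exists_notin.
have [j] : exists j : T, j \notin [:: i] by exact: exists_notin.
have [k] : exists k : T, k \notin [:: i; j] by exact: exists_notin.
rewrite !inE negb_or => /andP[ki kj] ji.
have [ij|ij] := ltP 0 (c i * c j); first by exists i, j; rewrite eq_sym.
have [ik|ik] := ltP 0 (c i * c k); first by exists i, k; rewrite eq_sym.
exists j, k; rewrite eq_sym; split=> //.
have ij' : c i * c j < 0 by rewrite lt_neqAle mulf_neq0 // c0.
have ik' : c i * c k < 0 by rewrite lt_neqAle mulf_neq0 // c0.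
exact: opposite_signs ij' ik'.
Qed.

(** With [u] and [y] the parts of the relation at [b, c] and at [d, e], the null
vector [v = r u + y] is a combination of four vectors; subtracting [r] times, or
once, the relation removes [b, c], or [d, e], from it. The four-vector
combination restricts the color of [v] only when [4 <= N]. *)
Lemma high_dimension (x : T -> 'rV[R]_N) : (4 <= N)%N ->
  (forall i, unit_vec (x i) /\ G (x i) = i) -> False.
Proof.
move=> N4 xP; pose s i := homog (x i).
have Ts : color_reps s.
  by move=> i; have [? ?] := xP i; split; [exact: homog_null|rewrite color_homog].
have s_lt0 i j : i != j -> mink (s i) (s j) < 0.
  move=> ij; have [[? xi] [? xj]] := (xP i, xP j).
  by apply: mink_lt0 => //; apply: contraNneq ij => e; rewrite -xi e xj.
have [la la0 laE] := color_reps_relation Ts.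
have [b [c [bc lbc]]] := pair_same_sign (leq_trans (isT : 1 <= 4)%N N4) la0.
have [d] : exists d : T, d \notin [:: b; c].
  by apply: exists_notin; rewrite /= !ltnS (leq_trans _ N4).
have [e] : exists e : T, e \notin [:: b; c; d].
  by apply: exists_notin; rewrite /= !ltnS (leq_trans _ N4).
rewrite !inE !negb_or => /and3P[eb ec ed] /andP[db dc].
pose u := la b *: s b + la c *: s c; pose y := la d *: s d + la e *: s e.
have ss i : mink (s i) (s i) = 0 by case: (Ts i) => -[].
have uu : mink u u < 0.
  have -> : mink u u = 2 * ((la b * la c) * mink (s b) (s c)).
    by rewrite /u !minkE !ss (minkC (s c)); ring.
  by rewrite pmulr_rlt0 // pmulr_rlt0 // s_lt0.
have [r vv] := line_meets_cone y uu; set v := r *: u + y in vv.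
pose m := [:: (b, r * la b); (c, r * la c); (d, la d); (e, la e)].
have vE : v = \sum_i combo m i *: s i.
  rewrite combo_sum !big_cons big_nil /= addr0 addrA.
  by rewrite /v /u /y scalerDr !scalerA.
have md : combo m d = la d.
  rewrite !combo_cons combo_nil !(eq_sym _ d) (negbTE db) (negbTE dc) eqxx.
  by rewrite (eq_sym d) (negbTE ed); ring.
have me : combo m e = la e.
  rewrite !combo_cons combo_nil !(eq_sym _ e) (negbTE eb) (negbTE ec) eqxx.
  by rewrite (negbTE ed); ring.
have mb : combo m b = r * la b.
  rewrite !combo_cons combo_nil eqxx (eq_sym c) (negbTE bc) (negbTE db) (negbTE eb).
  ring.
have mc : combo m c = r * la c.
  rewrite !combo_cons combo_nil eqxx (negbTE bc) (negbTE dc) (negbTE ec).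
  ring.
have nv : null v.
  split=> //; apply: contraNneq (la0 d) => v0; rewrite -md; apply/eqP.
  apply: (color_reps_indep Ts); last by rewrite -vE.
  by apply: leq_trans (combo_supp m) _; rewrite /= ltnW.
(* Subtracting [k] times the relation removes the colors [i] and [j]. *)
have shift (k : R) (i j : T) : i != j ->
    combo m i = k * la i -> combo m j = k * la j ->
    color v \notin [:: i; j].
  move=> ij mi mj.
  have vE' : v = \sum_l (combo m l - k * la l) *: s l.
    under eq_bigr do rewrite scalerBl -scalerA.
    by rewrite sumrB -vE -scaler_sumr laE scaler0 subr0.
  have : combo m (color v) - k * la (color v) != 0.
    apply: (span_colors (c := fun l => combo m l - k * la l) Ts nv vE').
    apply: (@leq_trans #|~: [set i; j]%SET|).
      apply/subset_leq_card/fintype.subsetP => l; rewrite !inE.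
      apply: contraNN => /orP[/eqP ->|/eqP ->];
      by rewrite ?mi ?mj subrr.
    by rewrite cardsCs finset.setCK cards2 ij card_ord subn2.
  by apply: contraNN; rewrite !inE => /orP[/eqP ->|/eqP ->];
    rewrite ?mi ?mj subrr.
have := in_span_colors (r := m) Ts nv N4; rewrite -combo_sum => /(_ vE).
rewrite /= !inE => /or4P[] cv.
- by have := shift r b c bc mb mc; rewrite !inE cv.
- by have := shift r b c bc mb mc; rewrite !inE cv orbT.
- have := shift 1 d e; rewrite eq_sym ed !mul1r md me !inE cv.
  by move=> /(_ isT erefl erefl).
- have := shift 1 d e; rewrite eq_sym ed !mul1r md me !inE cv orbT.
  by move=> /(_ isT erefl erefl).
Qed.

(** * The sphere of dimension two *)

(** For spacelike [P] this finds an isotropic vector in the span of [c, d, P] and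
orthogonal to [P]: a point where the circle is touched by a tangent from [P]. The
sign hypothesis makes the discriminant of the resulting quadratic equation
nonnegative. *)
Lemma tangent_vector (P c d : V) :
  0 < mink P P -> mink c c = 0 -> mink d d = 0 -> mink c d < 0 ->
  0 <= mink c P * mink d P ->
  exists t0 t1 th : R, [/\ (t0 != 0) || (t1 != 0),
    mink (t0 *: c + t1 *: d - th *: P) (t0 *: c + t1 *: d - th *: P) = 0
    & mink (t0 *: c + t1 *: d - th *: P) P = 0].
Proof.
move=> PP cc dd cd; set g := mink c P; set h := mink d P => gh.
have [h0|h0] := eqVneq h 0.
  exists 0, 1, 0; rewrite oner_eq0 orbT !scale0r scale1r subr0 add0r.
  by split.
have [||t tE] := @quadratic_root _ (h ^+ 2) (g * h - mink c d * mink P P) (g ^+ 2).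
- by rewrite expf_neq0.
- have -> : (g * h - mink c d * mink P P) ^+ 2 - h ^+ 2 * g ^+ 2 =
      - (mink c d * mink P P) * (2 * (g * h) - mink c d * mink P P) by ring.
  have cdP : mink c d * mink P P < 0 by rewrite pmulr_llt0.
  by rewrite mulr_ge0 // ?oppr_ge0 ?ltW // subr_gt0 (lt_le_trans cdP) // mulr_ge0.
have P0 : mink P P != 0 by rewrite gt_eqF.
exists 1, t, ((g + t * h) / mink P P); rewrite oner_eq0; split=> //.
  rewrite !minkE cc dd (minkC P c) (minkC P d) (minkC d c) -/g -/h.
  apply: (mulfI P0); rewrite [RHS]mulr0 -[RHS]oppr0 -[in RHS]tE; field.
  exact: P0.
by rewrite !minkE -/g -/h; field; exact: P0.
Qed.

Lemma sum_five (F : T -> V) (a b c d e : T) : N = 3%N ->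
  uniq [:: a; b; c; d; e] -> \sum_i F i = F a + F b + F c + F d + F e.
Proof.
move=> N3 Hu; transitivity (\sum_(i <- [:: a; b; c; d; e]) F i).
  apply/perm_big/uniq_perm; rewrite ?index_enum_uniq // => i.
  rewrite mem_index_enum; apply/esym/contraT => iN.
  have : uniq [:: i; a; b; c; d; e] by rewrite cons_uniq iN.
  move/card_uniqP => /= iU; have := max_card (mem [:: i; a; b; c; d; e]).
  by rewrite iU card_ord N3.
by rewrite !big_cons big_nil addr0 !addrA.
Qed.

(** If the tangent point [x] of the circle [c d e] has the color of [c], then it can
play the role of [c], and [no_tangency] applies. *)
Lemma no_tangent_point (s : T -> V) (a b c d e : T) (x : V)
    (la lb lc ld le mc md me : R) :
  N = 3%N -> color_reps s -> uniq [:: a; b; c; d; e] -> la != 0 ->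
  la *: s a + lb *: s b + lc *: s c + ld *: s d + le *: s e = 0 ->
  null x -> x = mc *: s c + md *: s d + me *: s e ->
  mink x (la *: s a + lb *: s b) = 0 -> color x = c -> False.
Proof.
move=> N3 Ts Hu la0 laE nx xE xP xc.
have cde : c \notin [:: d; e].
  by have := Hu; rewrite (cat_uniq [:: a; b] [:: c; d; e]) => /and3P[_ _ /= /andP[]].
have mc0 : mc != 0.
  apply: contraNneq cde => mc0.
  rewrite -xc; apply: (in_span_colors (r := [:: (d, md); (e, me)]) Ts nx).
    by rewrite /= N3.
  by rewrite !big_cons big_nil addr0 xE mc0 scale0r add0r.
have ns i : null (s i) by case: (Ts i).
have cs i : color (s i) = i by case: (Ts i).
apply: (no_tangency (R := R) (color := color) colorZ color_sep _
    nx (ns d) (ns e) (ns a) (ns b) _ la0 (be := lb) (xi := - lc / mc)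
    (ga := - (ld - lc * md / mc)) (ep := - (le - lc * me / mc))).
- by move=> v1 v2 v3 v4 c1 c2 c3 c4; apply: (rainbow_independent _ Ts); rewrite N3.
- rewrite !cs xc; apply: etrans Hu; apply: perm_uniq; apply/permP => Q /=; ring.
- have -> : la *: s a + lb *: s b = - (lc *: s c + ld *: s d + le *: s e).
    by apply/eqP; rewrite -addr_eq0 !addrA laE.
  by rewrite xE; apply/rowP => i; rewrite !mxE; field.
- by rewrite minkC.
Qed.

(** The coefficients of the relation sum to [0], because all the vectors have time
[1]. So two of them, at [a] and [b], have opposite signs, which makes
[P = la a s_a + la b s_b] spacelike: geometrically [a] and [b] lie on the same
side of the circle [c d e], so [P] lies outside it. Two of the three numbers
[mink (s c) P], [mink (s d) P], [mink (s e) P] have a nonnegative product, as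
[tangent_vector] requires. *)
Lemma dimension_two (x : T -> 'rV[R]_N) : N = 3%N ->
  (forall i, unit_vec (x i) /\ G (x i) = i) -> False.
Proof.
move=> N3 xP; have N_ge3 : (3 <= N)%N by rewrite N3.
have [s sE] : {s | forall i, s i = homog (x i)} by exists (fun i => homog (x i)).
have Ts : color_reps s.
  by move=> i; have [? ?] := xP i; rewrite sE; split;
    [exact: homog_null|rewrite color_homog].
have s_lt0 i j : i != j -> mink (s i) (s j) < 0.
  move=> ij; have [[? xi] [? xj]] := (xP i, xP j).
  by rewrite !sE; apply: mink_lt0 => //; apply: contraNneq ij => e; rewrite -xi e xj.
have ss i : mink (s i) (s i) = 0 by case: (Ts i) => -[].
have [la la0 laE] := color_reps_relation Ts.
have la_sum : \sum_i la i = 0.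
  have tE v : time v = v 0 (lshift N 0) by rewrite /time mxE.
  have := congr1 (@time R N) laE; rewrite !tE summxE mxE => E.
  rewrite -[RHS]E; apply: eq_bigr => i _.
  by rewrite mxE -tE sE time_homog mulr1.
have [a [b lab]] : exists a b, la a * la b < 0.
  have [a _] : exists a : T, a \notin [::] by exact: exists_notin.
  exists a; apply/existsP; apply: contraT => /existsPn h.
  have h' i : true -> 0 <= la a * la i by move=> _; rewrite leNgt.
  have := @psumr_eq0 _ _ (index_enum T) xpredT _ h'.
  rewrite -mulr_sumr la_sum mulr0 eqxx => /esym/allP/(_ a (mem_index_enum a)).
  by rewrite mulf_eq0 orbb (negbTE (la0 a)).
have ab : a != b.
  by apply: contraTneq lab => ->; rewrite -leNgt -expr2 sqr_ge0.
pose P := la a *: s a + la b *: s b.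
have PP : 0 < mink P P.
  have -> : mink P P = 2 * ((la a * la b) * mink (s a) (s b)).
    by rewrite /P !minkE !ss (minkC (s b)); ring.
  by rewrite pmulr_rgt0 // nmulr_rgt0 // s_lt0.
have core c d e : uniq [:: a; b; c; d; e] ->
    0 <= mink (s c) P * mink (s d) P -> False.
  move=> Hu cdP.
  have cd : c != d.
    by apply: contraTneq Hu => ->; rewrite /= !inE eqxx /= !andbF.
  have [t0 [t1 [th [t01 vv vP]]]] :=
    tangent_vector PP (ss c) (ss d) (s_lt0 _ _ cd) cdP.
  set v := t0 *: s c + t1 *: s d - th *: P in vv vP.
  have rel := laE; rewrite (sum_five _ N3 Hu) in rel.
  have vE : v = (t0 + th * la c) *: s c + (t1 + th * la d) *: s d
      + (th * la e) *: s e.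
    have PE : P = - (la c *: s c + la d *: s d + la e *: s e).
      by apply/eqP; rewrite -addr_eq0 !addrA rel.
    by rewrite /v PE; apply/rowP => i; rewrite !mxE; ring.
  have nv : null v.
    split=> //; apply: contraTneq t01 => v0.
    pose r := [:: (a, - th * la a); (b, - th * la b); (c, t0); (d, t1)].
    have r0 i : combo r i = 0.
      apply: (color_reps_indep Ts).
        by apply: leq_trans (combo_supp r) _; rewrite /= N3.
      rewrite combo_sum !big_cons big_nil /= -[RHS]v0 /v /P.
      by apply/rowP => j; rewrite !mxE; ring.
    move: Hu; rewrite /= !inE !negb_or.
    case/and5P=> /and4P[_ ac ad _] /and3P[bc bd _] /andP[_ _] _ _.
    have := r0 c; have := r0 d; rewrite !combo_cons !combo_nil !eqxx.
    rewrite (negbTE ac) (negbTE ad) (negbTE bc) (negbTE bd) (negbTE cd) (eq_sym d).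
    by rewrite (negbTE cd) !add0r !addr0 => -> ->; rewrite eqxx.
  have := in_span_colors (r := [:: (c, t0 + th * la c); (d, t1 + th * la d);
    (e, th * la e)]) Ts nv N_ge3; rewrite /= !big_cons big_nil addr0 addrA.
  move=> /(_ vE); rewrite !inE => /or3P[] /eqP cv.
  - exact: (no_tangent_point N3 Ts Hu (la0 a) rel nv vE vP cv).
  - apply: (no_tangent_point (a := a) (b := b) (c := d) (d := c) (e := e)
      (lb := la b) (lc := la d) (ld := la c) (le := la e)
      (mc := t1 + th * la d) (md := t0 + th * la c) (me := th * la e)
      N3 Ts _ (la0 a) _ nv _ vP cv).
    + by apply: etrans Hu; apply: perm_uniq; apply/permP => Q /=; ring.
    + by rewrite -[RHS]rel; apply/rowP => j; rewrite !mxE; ring.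
    + by rewrite vE; congr (_ + _); rewrite addrC.
  - apply: (no_tangent_point (a := a) (b := b) (c := e) (d := c) (e := d)
      (lb := la b) (lc := la e) (ld := la c) (le := la d)
      (mc := th * la e) (md := t0 + th * la c) (me := t1 + th * la d)
      N3 Ts _ (la0 a) _ nv _ vP cv).
    + by apply: etrans Hu; apply: perm_uniq; apply/permP => Q /=; ring.
    + by rewrite -[RHS]rel; apply/rowP => j; rewrite !mxE; ring.
    + by rewrite vE addrC addrA.
have [c] : exists c : T, c \notin [:: b; a] by apply: exists_notin; rewrite /= N3.
have [d] : exists d : T, d \notin [:: c; b; a] by apply: exists_notin; rewrite /= N3.
have [e] : exists e : T, e \notin [:: d; c; b; a].
  by apply: exists_notin; rewrite /= N3.
move=> e_ d_ c_.
have Hu : uniq [:: e; d; c; b; a] by rewrite !cons_uniq e_ d_ c_ inE eq_sym ab.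
have perm r : (forall Q, count Q r = count Q [:: e; d; c; b; a]) -> uniq r.
  by move=> Er; apply: etrans Hu; apply: perm_uniq; apply/permP.
have [cd|cd] := leP 0 (mink (s c) P * mink (s d) P).
  by apply: (core c d e) => //; apply: perm => Q /=; ring.
have [ce|ce] := leP 0 (mink (s c) P * mink (s e) P).
  by apply: (core c e d) => //; apply: perm => Q /=; ring.
apply: (core d e c); first by apply: perm => Q /=; ring.
exact/ltW/(opposite_signs cd ce).
Qed.

End Coloring.

(** * The coloring theorem *)

(** The matrix [a] is the normal covector of the hyperplane and [J] a set of colors
that occur on it. *)
Lemma rich_hyperplane (R : realType) (N : nat) (G : 'rV[R]_N -> 'I_N.+2)
    (x : 'I_N.+2 -> 'rV[R]_N) : (3 <= N)%N ->
  (forall i, unit_vec (x i) /\ G (x i) = i) ->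
  exists (a : 'cV[R]_(1 + N)) (J : {set 'I_N.+2}) (s : 'I_N.+2 -> 'rV[R]_(1 + N)),
    [/\ a != 0, color_reps G s, forall i, i \in J -> s i *m a = 0 & (N < #|J|)%N].
Proof.
move=> N3 xP; apply: contrapT => no_rich.
have few (a : 'cV[R]_(1 + N)) (J : {set 'I_N.+2}) (s : 'I_N.+2 -> 'rV[R]_(1 + N)) :
    a != 0 -> color_reps G s -> (forall i, i \in J -> s i *m a = 0) -> (#|J| <= N)%N.
  move=> a0 Ts sa; rewrite leqNgt; apply/negP => JN.
  by apply: no_rich; exists a, J, s.
move: N3; rewrite leq_eqVlt => /orP[/eqP N3|N4].
  exact: (dimension_two few (esym N3) xP).
exact: (high_dimension few N4 xP).
Qed.

Lemma midpoint_inside (R : realType) (n : nat) (x y : 'rV[R]_n.+1) :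
  unit_vec x -> unit_vec y -> x != y -> open_unit_ball (2^-1 *: (x + y)).
Proof.
move=> x1 y1 xy; rewrite /open_unit_ball /=.
have -> : \sum_i (2^-1 *: (x + y)) 0 i ^+ 2 = 4^-1 *
    (\sum_i x 0 i ^+ 2 + \sum_i y 0 i ^+ 2 + 2 * \sum_i x 0 i * y 0 i).
  rewrite mulr_sumr -!big_split mulr_sumr; apply: eq_bigr => i _.
  by rewrite !mxE /=; field.
by rewrite x1 y1; have := dot_lt1 x1 y1 xy; lra.
Qed.

Lemma mul_homog (R : realType) (N : nat) (a : 'cV[R]_(1 + N)) (x : 'rV[R]_N) :
  (homog x *m a) 0 0 = usubmx a 0 0 + \sum_i (dsubmx a)^T 0 i * x 0 i.
Proof.
rewrite -[a in LHS]vsubmxK /homog mul_row_col mul1mx mxE; congr (_ + _).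
by rewrite mxE; apply: eq_bigr => i _; rewrite [in RHS]mxE mulrC.
Qed.

Lemma null_on_hyperplane (R : realType) (N : nat) (a : 'cV[R]_(1 + N))
    (v : 'rV[R]_(1 + N)) : null v -> v *m a = 0 ->
  \sum_i (dsubmx a)^T 0 i * sphere_pt v 0 i = - usubmx a 0 0.
Proof.
move=> nv va; have : (v *m a) 0 0 = 0 by rewrite va mxE.
rewrite {1}(null_as_homog nv) -scalemxAl mxE mul_homog => /eqP.
by rewrite mulf_eq0 (negbTE (null_time nv)) /= addrC addr_eq0 => /eqP.
Qed.

Local Open Scope classical_set_scope.
Local Open Scope ring_scope.
Local Open Scope card_scope.

Theorem theorem1p1 (R : realType) (n k : nat) (hn : (2 <= n)%N)
    (hk : (n + 3 <= k)%N) (Gamma : @sphere R n -> 'I_k)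
    (hGamma : full_coloring Gamma) :
  exists S : set 'rV[R]_n.+1,
    codim1_sphere S /\ `I_(n + 2) #<= Gamma @` (set_val @^-1` S).
Proof.
(* All colors from [n + 2] on are merged into one. *)
pose merge (i : 'I_k) : 'I_n.+3 := inord (minn i n.+2).
have [p0 _] : exists p : @sphere R n, True.
  have k0 : (0 < k)%N by apply: leq_trans hk; rewrite addn3.
  by have [p _ _] := hGamma (Ordinal k0) I; exists p.
have /choice[P PE] : forall x : 'rV[R]_n.+1, exists p : @sphere R n,
    unit_vec x -> set_val p = x.
  move=> x.
  have [x1|x1] := pselect (unit_vec x); last by exists p0.
  by exists (SigSub (mem_set x1 : x \in @sphere R n)).
pose G x := merge (Gamma (P x)).
have /choice[x xP] : forall i : 'I_n.+3, exists x, unit_vec x /\ G x = i.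
  move=> i; have ik : (i < k)%N.
    by apply: leq_trans (ltn_ord i) _; rewrite -addn3.
  have [p _ pi] := hGamma (Ordinal ik) I; exists (set_val p).
  have p1 : unit_vec (set_val p) by exact: set_mem (valP p).
  split=> //; rewrite /G (_ : P _ = p); last by apply: val_inj; exact: PE.
  have iN : minn i n.+2 = i by apply/minn_idPl; rewrite -ltnS.
  by rewrite pi /merge /= iN inord_val.
have [a [J [s [a0 Ts sa JN]]]] := rich_hyperplane (hn : 3 <= n.+1)%N xP.
have ns i : null (s i) by case: (Ts i).
pose X i := sphere_pt (s i); have X1 i : unit_vec (X i) by exact: null_unit.
have GX i : G (X i) = i by case: (Ts i).
pose nrm : 'rV[R]_n.+1 := (dsubmx a)^T; pose b := - usubmx a 0 0.
have Xa i : i \in J -> \sum_j nrm 0 j * X i 0 j = b.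
  by move=> iJ; apply: null_on_hyperplane => //; exact: sa.
have /card_gt1P[i [j [iJ jJ ij]]] : (1 < #|J|)%N by exact: leq_trans JN.
have nrm0 : nrm != 0.
  apply: contraNneq a0 => nrm0; have := Xa i iJ.
  rewrite nrm0 big1 => [b0|l _]; last by rewrite mxE mul0r.
  rewrite -[a]vsubmxK -[dsubmx a]trmxK -/nrm nrm0 trmx0.
  suff -> : usubmx a = 0 by rewrite col_mx0.
  apply/matrixP => l m; rewrite !ord1 [RHS]mxE.
  by apply/eqP; rewrite -oppr_eq0 -/b -b0.
pose H : set 'rV[R]_n.+1 := [set y | \sum_l nrm 0 l * y 0 l = b].
exists (H `&` @sphere R n); split.
  exists H; split=> //; first by exists nrm, b.
  exists (2^-1 *: (X i + X j)); split; last first.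
    apply: midpoint_inside => //; apply: contraNneq ij => e.
    by rewrite -(GX i) -(GX j) e.
  rewrite /H /=.
  have -> : \sum_l nrm 0 l * (2^-1 *: (X i + X j)) 0 l =
     2^-1 * (\sum_l nrm 0 l * X i 0 l + \sum_l nrm 0 l * X j 0 l).
    rewrite -big_split mulr_sumr; apply: eq_bigr => l _.
    by rewrite !mxE /=; ring.
  by rewrite !Xa //; field.
pose f l := Gamma (P (X (nth i (enum J) l))).
have fJ l : (l < n + 2)%N -> (l < size (enum J))%N.
  by rewrite addn2 -cardE => /leq_trans; apply.
have f_inj : {in `I_(n + 2) &, injective f}.
  move=> l m; rewrite !inE /= => /fJ lJ /fJ mJ fE.
  have : merge (f l) = merge (f m) by rewrite fE.
  rewrite -/(G _) -/(G _) !GX => /eqP.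
  by rewrite nth_uniq ?enum_uniq // => /eqP.
rewrite -(card_le_eql (inj_card_eq f_inj)); apply: subset_card_le.
move=> _ [l /= /fJ lJ <-]; exists (P (X (nth i (enum J) l))) => //=.
have nJ : nth i (enum J) l \in J by rewrite -mem_enum mem_nth.
rewrite PE //; split; last exact: X1.
exact: Xa.
Qed.
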